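(* Let $r$ be an odd positive integer and let $n=2r$. Let $K$ be a field of characteristic $2$ with $|K|\geq r+1$, and let $V$ be a vector space of dimension $n$ over $K$. Let $\mathcal{M}$ be a subspace of $\mathrm{Symm}(V)$ of dimension $3r$ in which the rank of any non-zero element is $r$ or $n$. For $u\in V$ put $\mathcal{K}_u=\{f\in\mathcal{M}: f(u,v)=0 \text{ for all } v\in V\}$. Then the following hold. (1) If $\mathcal{N}$ is any $r$-dimensional constant rank $r$ subspace of $\mathcal{M}$, then $\mathcal{N}=\mathcal{K}_u$ for some non-zero $u\in V$. (2) If $\mathcal{N}$ and $\mathcal{N}_1$ are different $r$-dimensional constant rank $r$ subspaces of $\mathcal{M}$, then $\mathcal{N}\cap\mathcal{N}_1=0$. (3) For each $r$-dimensional constant rank $r$ subspace of $\mathcal{M}$, all its non-zero elements have the same radical, and these common radicals (as the subspace ranges over all $r$-dimensional constant rank $r$ subspaces of $\mathcal{M}$) form a spread of $r$-dimensional subspaces that cover $V$. (4) If $\mathcal{N}$ and $\mathcal{N}_1$ are different $r$-dimensional constant rank $r$ subspaces of $\mathcal{M}$, then the $n$-dimensional subspace $\mathcal{N}\oplus\mathcal{N}_1$ contains no non-zero alternating elements and no elements of rank $r$ other than elements in $\mathcal{N}$ and $\mathcal{N}_1$. Thus \[ (\mathcal{N}\oplus\mathcal{N}_1)\cap\mathcal{N}_2=0,\qquad \mathcal{M}=\mathcal{N}\oplus\mathcal{N}_1\oplus\mathcal{N}_2 \] for any $r$-dimensional constant rank $r$ subspace $\mathcal{N}_2$ of $\mathcal{M}$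 different from $\mathcal{N}$ and $\mathcal{N}_1$. (5) For $\mathcal{N}$ and $\mathcal{N}_1$ as in (4), we also have \[ \mathcal{M}=\mathcal{N}\oplus\mathcal{N}_1\oplus(\mathcal{M}\cap\mathrm{Alt}(V)), \] and thus $\mathcal{M}\cap\mathrm{Alt}(V)$ is an $r$-dimensional subspace of alternating bilinear forms all of whose non-zero elements have rank $n$.
   Context: $\mathrm{Symm}(V)$ denotes the $K$-vector space of symmetric bilinear forms $V\times V\to K$, and $\mathrm{Alt}(V)$ its subspace of alternating bilinear forms (those $f$ with $f(v,v)=0$ for all $v\in V$; in characteristic $2$ these are symmetric). The radical of a form $f$ is $\mathrm{rad}\,f=\{u\in V: f(u,v)=0 \text{ for all } v\in V\}$, and its rank is $\dim V-\dim \mathrm{rad}\,f$. A constant rank $r$ subspace of $\mathrm{Symm}(V)$ is a subspace all of whose non-zero elements have rank $r$. A spread of $r$-dimensional subspaces covering $V$ is a collection of $r$-dimensional subspaces of $V$, any two different members of which intersect trivially, and whose union is $V$. *)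

(* Defs.v *)
From HB Require Import structures.
From mathcomp Require Import all_boot all_order all_algebra.

Set Implicit Arguments.
Unset Strict Implicit.
Unset Printing Implicit Defensive.

Import GRing.Theory.
Local Open Scope ring_scope.

(* Bilinear forms V x V -> K in curried form, the value at (u, v) being f u v;
   they inherit the vectType structure of 'Hom. *)
Notation bilform K V := 'Hom(V, 'Hom(V, K^o)).

Section BilinearForms.

Variables (K : fieldType) (V : vectType K).
Implicit Types (f : bilform K V) (M N : {vspace bilform K V}).

Definition form_rad f : {vspace V} := lker f.

Lemma form_radP f u :
  reflect (forall v, f u v = 0) (u \in form_rad f).
Proof.
rewrite memv_ker; apply: (iffP eqP) => [-> v|fu0]; first by rewrite lfunE.
by apply/lfunP => v; rewrite fu0 lfunE.
Qed.

Definition form_rank f : nat := (\dim {:V} - \dim (form_rad f))%N.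

Definition form_at (u : V) f : 'Hom(V, K^o) := f u.

Lemma form_at_is_linear u : linear (form_at u).
Proof. by move=> a f g; rewrite /form_at add_lfunE scale_lfunE. Qed.
HB.instance Definition _ u :=
  GRing.isLinear.Build K (bilform K V) 'Hom(V, K^o) *:%R (form_at u)
    (form_at_is_linear u).

Definition forms_killing M (u : V) : {vspace bilform K V} :=
  (M :&: lker (linfun (form_at u)))%VS.

Lemma forms_killingP M u f :
  reflect (f \in M /\ forall v, f u v = 0) (f \in forms_killing M u).
Proof.
rewrite memv_cap memv_ker lfunE /= /form_at -memv_ker.
by apply: (iffP andP) => -[fM /form_radP].
Qed.

Definition form_eval (u v : V) f : K^o := f u v.

Lemma form_eval_is_linear u v : linear (form_eval u v).
Proof. by move=> a f g; rewrite /form_eval !(add_lfunE, scale_lfunE). Qed.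
HB.instance Definition _ u v :=
  GRing.isLinear.Build K (bilform K V) K^o *:%R (form_eval u v)
    (form_eval_is_linear u v).

Let ev (u v : V) : 'Hom(bilform K V, K^o) := linfun (form_eval u v).

Let evE u v f : ev u v f = f u v. Proof. by rewrite lfunE. Qed.

Let b (i : 'I_(\dim {:V})) : V := (vbasis {:V})`_i.

(* A {vspace} has no comprehension over arbitrary linear conditions, so Symm(V)
   and Alt(V) are cut out by finitely many conditions on a basis of V; the
   pointwise definitions are SymmP and AltP. *)
Definition Symm : {vspace bilform K V} :=
  (\bigcap_i \bigcap_j lker (ev (b i) (b j) - ev (b j) (b i))%R)%VS.

Definition Alt : {vspace bilform K V} :=
  ((\bigcap_i lker (ev (b i) (b i))) :&:
   (\bigcap_i \bigcap_j lker (ev (b i) (b j) + ev (b j) (b i))%R))%VS.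

Let memv_bigcap (I : finType) (U : I -> {vspace bilform K V}) f :
  reflect (forall i, f \in U i) (f \in \bigcap_i U i)%VS.
Proof.
rewrite memvE; apply: (iffP subv_bigcapP) => fU i; first by rewrite memvE fU.
by rewrite -memvE.
Qed.

Let expand f u v : f u v =
  \sum_i \sum_j coord (vbasis {:V}) i u * (coord (vbasis {:V}) j v * f (b i) (b j)).
Proof.
rewrite {1}(coord_vbasis (memvf u)) linear_sum sum_lfunE.
apply: eq_bigr => i _; rewrite {1}(coord_vbasis (memvf v)) linear_sum /=.
by apply: eq_bigr => j _; rewrite !linearZ /= scale_lfunE mulrCA.
Qed.

Let formDl f u v w : f (u + v) w = f u w + f v w.
Proof. by rewrite [f (u + v)]linearD add_lfunE. Qed.

Lemma SymmP f : reflect (forall u v, f u v = f v u) (f \in Symm).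
Proof.
apply: (iffP (memv_bigcap _ _)) => [fS u v|fS i]; last first.
  apply/memv_bigcap => j.
  by rewrite memv_ker add_lfunE opp_lfunE !evE fS subrr.
have fb i j : f (b i) (b j) = f (b j) (b i).
  apply/eqP; rewrite -subr_eq0; move/memv_bigcap: (fS i) => /(_ j).
  by rewrite memv_ker add_lfunE opp_lfunE !evE.
rewrite expand [RHS]expand exchange_big; apply: eq_bigr => i _.
by apply: eq_bigr => j _; rewrite mulrCA fb.
Qed.

Lemma AltP f : reflect (forall v, f v v = 0) (f \in Alt).
Proof.
rewrite memv_cap; apply: (iffP andP) => [[/memv_bigcap fD /memv_bigcap fA]|fA].
  have fb i j : f (b i) (b j) = - f (b j) (b i).
    apply/eqP; rewrite -addr_eq0; move/memv_bigcap: (fA i) => /(_ j).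
    by rewrite memv_ker add_lfunE !evE.
  have fN u v : f u v = - f v u.
    rewrite expand (expand f v) exchange_big -sumrN; apply: eq_bigr => i _.
    by rewrite -sumrN; apply: eq_bigr => j _; rewrite mulrCA fb !mulrN.
  move=> v; rewrite (coord_vbasis (memvf v)).
  apply: (big_ind (fun w => f w w = 0)) => [|x y fx fy|i _].
  - by rewrite linear0.
  - by rewrite formDl !linearD /= fx fy fN add0r addr0 addNr.
  rewrite !linearZ /= scale_lfunE.
  by have := fD i; rewrite memv_ker evE => /eqP ->; rewrite !scaler0.
split; apply/memv_bigcap => i; first by rewrite memv_ker evE fA.
apply/memv_bigcap => j; rewrite memv_ker add_lfunE !evE.
have := fA (b i + b j); rewrite formDl !linearD /= !fA add0r addr0.
by rewrite addrC => ->.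
Qed.

Definition constant_rank (r : nat) N : Prop :=
  forall f, f \in N -> f != 0 -> form_rank f = r.

Definition dim_constant_rank (r : nat) M N : Prop :=
  [/\ (N <= M)%VS, \dim N = r & constant_rank r N].

Definition common_radical N (R : {vspace V}) : Prop :=
  forall f, f \in N -> f != 0 -> form_rad f = R.

Definition spread (r : nat) (S : {vspace V} -> Prop) : Prop :=
  [/\ forall U, S U -> \dim U = r,
      forall U W, S U -> S W -> U <> W -> (U :&: W = 0)%VS
    & forall v : V, exists2 U, S U & v \in U].

End BilinearForms.
Arguments Symm {K} V.
Arguments Alt {K} V.

(* Main.v *)
From HB Require Import structures.
Require Import Defs.
From mathcomp Require Import all_boot all_order all_algebra.

Set Implicit Arguments.
Unset Strict Implicit.

Import GRing.Theory.
Local Open Scope ring_scope.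

(** Write q_f(v) = f(v, v). In characteristic 2 each q_f is additive and q_f(a v)
    = a^2 q_f(v), so q_f is determined by its values on a basis, and it vanishes
    exactly when f is alternating. Alternating forms have even rank, hence no
    form of odd rank r is alternating.

    The heart of the argument concerns a constant rank r subspace N with r odd.
    If f is a non-zero element of N, then every g in N satisfies q_g = 0 on
    rad f ([isotropic_on_rad]): otherwise a singular pencil B + tA with A
    invertible of order r would give a polynomial of degree r with at least
    r + 1 roots. So g in N is determined by the values of q_g on a basis of a
    complement W of rad f, where dim W = r. This gives dim N <= r, and if
    dim N = r then these values are arbitrary. In that case a vector w + x with
    w in W, x in rad f, on which all q_g vanish (in particular a vector in the
    radical of another element of N) must have w = 0. Hence all non-zero
    elements of N have the same radical
    ([odd_constant_rank_common_radical]).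

    Now let M be as in the theorem. For u <> 0 the space K_u of the elements of
    M that kill u has constant rank r, hence dimension at most r, and at least
    3r - 2r by counting; so dim K_u = r. An r-dimensional constant rank r
    subspace N lies in K_u for every non-zero u in its common radical, hence
    equals it. So two such subspaces with radicals that meet non-trivially
    coincide, which gives the spread.

    Finally let f and g be non-zero elements of two different such subspaces.
    Then V = rad f + rad g is a direct sum, orthogonal for h = f + g, and h
    restricts to a non-degenerate form on each summand. So h has rank n, and it
    is not alternating because rad f has odd dimension r. The decompositions of
    M follow by dimension count, using that the alternating forms in M are cut
    out by the n diagonal values, so that they have dimension at least
    3r - n = r. *)

(** * Bilinear forms and non-degeneracy on subspaces *)

Section BilinearForms.

Context {K : fieldType} {V : vectType K}.
Implicit Types (f g h : bilform K V) (U W : {vspace V}) (x y u v : V).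

Lemma formDl f u v w : f (u + v) w = f u w + f v w.
Proof. by rewrite [f (u + v)]linearD add_lfunE. Qed.

Lemma formZl f a u w : f (a *: u) w = a * f u w.
Proof. by rewrite [f (a *: u)]linearZ /= scale_lfunE. Qed.

Lemma formDr f u v w : f u (v + w) = f u v + f u w.
Proof. exact: linearD. Qed.

Lemma formZr f a u w : f u (a *: w) = a * f u w.
Proof. exact: linearZ. Qed.

Lemma formBr f u v w : f u (v - w) = f u v - f u w.
Proof. exact: linearB. Qed.

Lemma form_sym f u v : f \in Symm V -> f u v = f v u.
Proof. by move/SymmP; apply. Qed.

Lemma dim_cap_lker_ge (aT rT : vectType K) (p : 'Hom(aT, rT)) (U : {vspace aT}) :
  (\dim U <= \dim (U :&: lker p) + \dim {:rT})%N.
Proof. by rewrite -(limg_ker_dim p U) leq_add2l dimvS // subvf. Qed.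

Lemma dim_rV m : \dim {:'rV[K]_m} = m.
Proof. by rewrite dimvf dim_matrix mul1r. Qed.

Lemma dim_dual : \dim {:'Hom(V, K^o)} = \dim {:V}.
Proof. by rewrite !dimvf /dim /= muln1. Qed.

Definition nondegenerate_on f W : Prop :=
  forall x, x \in W -> (forall y, y \in W -> f x y = 0) -> x = 0.

Lemma nondegenerate_on_rank f W :
  nondegenerate_on f W -> (\dim W <= form_rank f)%N.
Proof.
move=> fW; have W0 : (W :&: form_rad f = 0)%VS.
  apply/eqP; rewrite -subv0; apply/subvP => x /memv_capP[xW /form_radP xf].
  by rewrite (fW x) ?mem0v // => y _; apply: xf.
rewrite /form_rank leq_subRL ?dimvS ?subvf //.
by rewrite addnC -dimv_disjoint_sum // dimvS ?subvf.
Qed.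

(** V / rad f carries a non-degenerate form, and any complement of rad f is a
    copy of it. *)
Lemma nondegenerate_on_compl f W : f \in Symm V ->
    (W :&: form_rad f = 0)%VS -> (W + form_rad f = fullv)%VS ->
  nondegenerate_on f W.
Proof.
move=> fS W0 WV x xW fx; apply/eqP; rewrite -memv0 -W0 memv_cap xW /=.
apply/form_radP => v; have: v \in (W + form_rad f)%VS by rewrite WV memvf.
case/memv_addP => w wW [z /form_radP zf ->].
by rewrite formDr fx // (form_sym _ _ fS) zf add0r.
Qed.

Definition gram f W : 'M[K]_(\dim W) :=
  \matrix_(i, j) f (vbasis W)`_i (vbasis W)`_j.

Lemma gram_lin f g (t : K) W : gram (f + t *: g) W = gram f W + t *: gram g W.
Proof. by apply/matrixP => i j; rewrite !mxE add_lfunE scale_lfunE add_lfunE scale_lfunE. Qed.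

Lemma mul_gram f W (c : 'rV_(\dim W)) j :
  (c *m gram f W) 0 j = f (\sum_i c 0 i *: (vbasis W)`_i) (vbasis W)`_j.
Proof.
rewrite linear_sum sum_lfunE mxE; apply: eq_bigr => i _.
by rewrite mxE linearZ /= scale_lfunE.
Qed.

(** A row vector in the left kernel of the Gram matrix is the coordinate vector
    of an element of W orthogonal to W. *)
Lemma gram_unitP f W : nondegenerate_on f W <-> gram f W \in unitmx.
Proof.
have bW (i : 'I_(\dim W)) : (vbasis W)`_i \in W by apply/vbasis_mem/mem_nth; rewrite size_tuple.
rewrite unitmxE unitfE; split=> [fW | /det0P f0 x xW fx].
  apply/det0P => -[c c0 cf]; move/negP: c0; apply; apply/eqP.
  pose x := \sum_i c 0 i *: (vbasis W)`_i.
  have x0 : x = 0.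
    apply: fW => [|y yW]; first by apply: memv_suml => i _; apply: memvZ.
    rewrite (coord_vbasis yW) linear_sum big1 // => j _.
    by rewrite linearZ /= -mul_gram cf mxE scaler0.
  apply/rowP => i; rewrite mxE.
  by have /freeP/(_ _ x0 i) := basis_free (vbasisP W).
have [//|x0] := eqVneq x 0; case: f0.
exists (\row_i coord (vbasis W) i x).
  apply: contraNneq x0 => /rowP c0; rewrite (coord_vbasis xW) big1 // => i _.
  by have := c0 i; rewrite !mxE => ->; rewrite scale0r.
apply/rowP => j; rewrite mul_gram mxE -[RHS](fx (vbasis W)`_j) //.
congr (f _ _); rewrite [RHS](coord_vbasis xW).
by apply: eq_bigr => i _; rewrite mxE.
Qed.

(** * Alternating forms *)

Lemma alt_skew f u v : f \in Alt V -> f v u = - f u v.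
Proof.
move/AltP => fA; apply/eqP; rewrite -addr_eq0; have := fA (u + v).
by rewrite formDl !formDr !fA add0r addr0 addrC => ->.
Qed.

Lemma dim_cap_hyperplane U (p : 'Hom(V, K^o)) x : x \in U -> p x != 0 ->
  \dim U = (\dim (U :&: lker p)).+1.
Proof.
move=> xU px; rewrite -(limg_ker_dim p U).
suff -> : (p @: U = fullv)%VS by rewrite dimvf /= addn1.
apply/vspaceP => z; rewrite memvf.
apply/memv_imgP; exists ((z / p x) *: x); first exact: memvZ.
by rewrite linearZ /= /GRing.scale /= divfK.
Qed.

(** Splitting off a hyperbolic plane, spanned by x and y with f(x, y) <> 0,
    leaves a non-degenerate alternating form on the orthogonal complement of the
    plane in W, of dimension smaller by 2. *)
Lemma alternating_even_dim f W : f \in Alt V -> nondegenerate_on f W ->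
  ~~ odd (\dim W).
Proof.
move=> fA; have [m] := ubnP (\dim W); elim: m W => // m IHm W.
rewrite ltnS => leWm fW.
have [->|W0] := eqVneq W 0%VS; first by rewrite dimv0.
have xW := memv_pick W; have := W0; rewrite -vpick0; set x := vpick W in xW *.
move=> x0.
have [y yW fxy] : exists2 y, y \in W & f x y != 0.
  have [|fxW] := boolP (W <= lker (f x))%VS; last first.
    by case/subvPn: fxW => y yW; rewrite memv_ker; exists y.
  move/subvP=> fx0; case/eqP: x0; apply: fW => // y /fx0.
  by rewrite memv_ker => /eqP.
have xx : f x x = 0 by move/AltP: fA; apply.
have yy : f y y = 0 by move/AltP: fA; apply.
have fyx : f y x != 0 by rewrite (alt_skew _ _ fA) oppr_eq0.
rewrite (dim_cap_hyperplane yW fxy).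
set W1 := (W :&: lker (f x))%VS.
have xW1 : x \in W1 by rewrite memv_cap xW memv_ker xx eqxx.
rewrite (dim_cap_hyperplane xW1 fyx) /= negbK.
set W2 := (W1 :&: lker (f y))%VS.
apply: IHm.
  have := leWm; rewrite (dim_cap_hyperplane yW fxy) (dim_cap_hyperplane xW1 fyx).
  by apply: leq_trans.
move=> z; rewrite !memv_cap !memv_ker => /andP[/andP[zW /eqP xz] /eqP yz] fz.
apply: fW => // w wW.
(* w2 is the component of w orthogonal to the plane spanned by x and y. *)
pose w2 := w - (f y w / f y x) *: x - (f x w / f x y) *: y.
have w2W : w2 \in W2.
  rewrite !memv_cap !memv_ker !memvB ?memvZ //=.
  by rewrite !(formBr, formZr) xx yy !mulr0 !divfK // !subr0 !subrr eqxx.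
have -> : w = w2 + ((f x w / f x y) *: y + (f y w / f y x) *: x).
  by rewrite addrA !subrK.
rewrite formDr fz // formDr !formZr (alt_skew x z fA) (alt_skew y z fA) xz yz.
by rewrite oppr0 !mulr0 !addr0.
Qed.

Lemma alternating_even_rank f : f \in Symm V -> f \in Alt V -> ~~ odd (form_rank f).
Proof.
move=> fS fA; rewrite /form_rank -dimv_compl; apply: alternating_even_dim fA _.
by apply: nondegenerate_on_compl; rewrite // 1?capvC ?capv_compl // addvC addv_complf.
Qed.

(** * Symmetric pencils of bounded rank *)

(** If g(x, x) <> 0, then V is the g-orthogonal sum of the line of x and its
    hyperplane x^perp. As x lies in rad f, this sum is orthogonal for the whole
    pencil g + t f, which has g(x, x) as its value at (x, x); so the rank of
    g + t f on the hyperplane is at most r - 1 for every t, while f still has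
    rank r there. Then every scalar t is an eigenvalue of one matrix of order r,
    which cannot be when there are more than r scalars. *)
Lemma isotropic_on_rad r f g x :
    (exists c : 'I_r.+1 -> K, injective c) ->
    f \in Symm V -> g \in Symm V -> form_rank f = r ->
    (forall t : K, (form_rank (g + t *: f)%R <= r)%N) ->
  x \in form_rad f -> g x x = 0.
Proof.
move=> [c c_inj] fS gS rf rgf xf; apply/eqP/negPn/negP => gxx.
have fx v : f x v = 0 by apply/form_radP: v.
(* W is a complement of rad f in V that lies in the hyperplane orthogonal to x
   under g. *)
pose U := lker (g x); pose W := (U :\: form_rad f)%VS.
have WU : (W <= U)%VS by apply: diffvSl.
have gxW w : w \in W -> g x w = 0.
  by move/(subvP WU); rewrite memv_ker => /eqP.
have W0 : (W :&: form_rad f = 0)%VS by apply: capv_diff.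
have WV : (W + form_rad f = fullv)%VS.
  apply/vspaceP => v; rewrite memvf.
  have : v - (g x v / g x x) *: x \in U.
    by rewrite memv_ker formBr formZr divfK // subrr.
  rewrite -(addv_diff_cap U (form_rad f)) => /memv_addP[w wW [z]].
  move=> /memv_capP[_ zf] /eqP; rewrite subr_eq -addrA => /eqP ->.
  by rewrite memv_add // memvD // memvZ.
have fW : nondegenerate_on f W by apply: nondegenerate_on_compl.
have dimW : \dim W = r.
  by rewrite -rf /form_rank -WV dimv_disjoint_sum // addnK.
have gfW t : ~ nondegenerate_on (g + t *: f) W.
  move=> hW; have := rgf t; apply/negP; rewrite -ltnNge.
  have hx v : (g + t *: f) x v = g x v.
    by rewrite !add_lfunE !scale_lfunE fx scaler0 addr0.
  have xW : (<[x]> :&: W = 0)%VS.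
    apply/eqP; rewrite -subv0; apply/subvP => z /memv_capP[/vlineP[a ->] /gxW].
    rewrite formZr => /eqP; rewrite mulf_eq0 (negPf gxx) orbF => /eqP->.
    by rewrite scale0r mem0v.
  have x0 : x != 0 by apply: contraNneq gxx => ->; rewrite linear0.
  suff /nondegenerate_on_rank : nondegenerate_on (g + t *: f) (<[x]> + W)%VS.
    by rewrite dimv_disjoint_sum // dim_vline x0 dimW add1n.
  move=> _ /memv_addP[_ /vlineP[a ->] [w wW ->]] hz.
  have hS : g + t *: f \in Symm V by rewrite memvD ?memvZ.
  have a0 : a = 0.
    have := hz x; rewrite (subvP (addvSl _ _)) ?memv_line // => /(_ isT)/eqP.
    rewrite formDl formZl (form_sym w x hS) !hx.
    by rewrite (gxW w) // addr0 mulf_eq0 (negPf gxx) orbF => /eqP.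
  rewrite a0 scale0r add0r; apply: hW => // y yW.
  by have := hz y; rewrite (subvP (addvSr _ _)) // a0 scale0r add0r; apply.
have /gram_unitP uA := fW.
(* With A and B the Gram matrices of f and g, a row v with v (B + tA) = 0 is an
   eigenvector of - B A^-1 for t. *)
pose C := - (gram g W *m invmx (gram f W)).
have rootC t : root (char_poly C) t.
  rewrite -eigenvalue_root_char; apply/eigenvalueP.
  have : ~~ (gram (g + t *: f) W \in unitmx) by apply/negP => /gram_unitP/gfW.
  rewrite unitmxE unitfE negbK => /det0P[v v0 vh]; exists v => //.
  move/eqP: vh; rewrite gram_lin mulmxDr -scalemxAr addr_eq0 => /eqP vg.
  by rewrite mulmxN mulmxA vg mulNmx opprK -scalemxAl mulmxK.
have c_uniq : uniq (codom c) by rewrite map_inj_uniq ?enum_uniq.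
have c_roots : all (root (char_poly C)) (codom c) by apply/allP.
have := max_poly_roots (monic_neq0 (char_poly_monic C)) c_roots c_uniq.
by rewrite size_char_poly size_codom card_ord dimW ltnn.
Qed.

(** * Diagonal values and constant rank spaces in characteristic 2 *)

Definition diagonal W f : 'rV[K]_(\dim W) :=
  \row_i f (vbasis W)`_i (vbasis W)`_i.

Lemma diagonal_is_linear W : linear (diagonal W).
Proof.
by move=> a f g; apply/rowP => i; rewrite !mxE !(add_lfunE, scale_lfunE).
Qed.
HB.instance Definition _ W :=
  GRing.isLinear.Build K (bilform K V) 'rV[K]_(\dim W) *:%R (diagonal W)
    (diagonal_is_linear W).

Lemma form_rad_eq0 f : form_rank f = \dim {:V} -> form_rad f = 0%VS.
Proof.
rewrite /form_rank => rf; apply/eqP.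
by rewrite -dimv_eq0 -(subKn (dimvS (subvf (form_rad f)))) rf subnn.
Qed.

Lemma form_rank0 : form_rank (0 : bilform K V) = 0%N.
Proof.
rewrite /form_rank; have -> : form_rad (0 : bilform K V) = fullv.
  by apply/vspaceP => v; rewrite memvf memv_ker lfunE eqxx.
exact: subnn.
Qed.

Section Characteristic2.

Hypothesis charK : 2%N \in [pchar K].

Lemma form_square_sum f u v : f \in Symm V ->
  f (u + v) (u + v) = f u u + f v v.
Proof.
move=> fS; rewrite formDl !formDr (form_sym v u fS) -addrA.
by rewrite (addrA (f u v)) (addrr_pchar2 charK) add0r.
Qed.

Lemma form_square_diagonal W f w : f \in Symm V -> w \in W ->
  f w w = \sum_i coord (vbasis W) i w ^+ 2 * diagonal W f 0 i.
Proof.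
move=> fS wW; rewrite {1 2}(coord_vbasis wW).
elim/big_rec2: _ => [|i y x _ IH]; first by rewrite linear0.
by rewrite form_square_sum // IH formZl formZr mxE mulrA expr2.
Qed.

(** A symmetric form is alternating as soon as its diagonal values on a basis
    vanish, and these are dim V linear conditions. *)
Lemma dim_alternating_ge (M : {vspace bilform K V}) : (M <= Symm V)%VS ->
  (\dim M <= \dim (M :&: Alt V) + \dim {:V})%N.
Proof.
move=> MS; apply: leq_trans (dim_cap_lker_ge (linfun (diagonal fullv)) M) _.
rewrite dim_rV leq_add2r dimvS //.
apply/subvP => f /memv_capP[fM]; rewrite memv_ker lfunE /= => /eqP f0.
rewrite memv_cap fM; apply/AltP => v.
rewrite (form_square_diagonal (subvP MS _ fM) (memvf v)) f0.
by rewrite big1 // => i _; rewrite mxE mulr0.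
Qed.

Section OddConstantRank.

Variables (r : nat) (N : {vspace bilform K V}).
Hypotheses (r_odd : odd r) (cardK : exists c : 'I_r.+1 -> K, injective c).
Hypotheses (NS : (N <= Symm V)%VS) (rankN : constant_rank r N).

Lemma constant_rank_isotropic f g x : f \in N -> f != 0 -> g \in N ->
  x \in form_rad f -> g x x = 0.
Proof.
move=> fN f0 gN; apply: (isotropic_on_rad cardK); rewrite ?(subvP NS) ?rankN //.
move=> t; have [->|gf0] := eqVneq (g + t *: f) 0; first by rewrite form_rank0.
by rewrite rankN // memvD ?memvZ.
Qed.

(** An element of N that is isotropic on a basis of a complement of rad f is
    isotropic on rad f as well, hence is alternating, which the odd rank
    excludes. *)
Lemma diagonal_injective f : f \in N -> f != 0 ->
  (N :&: lker (linfun (diagonal (form_rad f)^C)) = 0)%VS.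
Proof.
move=> fN f0; apply/eqP; rewrite -subv0; apply/subvP => g /memv_capP[gN].
rewrite memv_ker lfunE /= => /eqP dg; rewrite memv0; apply/negPn/negP => g0.
have gS := subvP NS _ gN.
suff gA : g \in Alt V.
  by have := alternating_even_rank gS gA; rewrite rankN // r_odd.
apply/AltP => v; have: v \in (form_rad f + (form_rad f)^C)%VS.
  by rewrite addv_complf memvf.
case/memv_addP => x xf [w wW ->]; rewrite form_square_sum //.
rewrite (constant_rank_isotropic fN) // add0r (form_square_diagonal gS wW) dg.
by rewrite big1 // => i _; rewrite mxE mulr0.
Qed.

Lemma dim_form_rad_compl f : f \in N -> f != 0 -> \dim (form_rad f)^C = r.
Proof. by move=> fN f0; rewrite dimv_compl; apply: rankN. Qed.

Lemma odd_constant_rank_dim : (\dim N <= r)%N.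
Proof.
have [->|N0] := eqVneq N 0%VS; first by rewrite dimv0.
have fN := memv_pick N; have := N0; rewrite -vpick0 => f0.
have := dim_cap_lker_ge (linfun (diagonal (form_rad (vpick N))^C)) N.
rewrite diagonal_injective // dimv0 add0n dim_rV.
by rewrite dim_form_rad_compl.
Qed.

(** When dim N = r, the diagonal map of a complement W of rad f maps N onto all
    row vectors. For v = x + w in rad g, with x in rad f and w in W, the form h
    in N with diagonal the j-th unit vector has h(v, v) equal to the square of
    the j-th coordinate of w; but h(v, v) = 0 since v lies in rad g. *)
Lemma odd_constant_rank_common_radical f g : \dim N = r ->
  f \in N -> f != 0 -> g \in N -> g != 0 -> form_rad f = form_rad g.
Proof.
move=> dimN fN f0 gN g0; apply/eqP; rewrite eq_sym eqEdim.
have rad_dim h : h \in N -> h != 0 -> \dim (form_rad h) = (\dim {:V} - r)%N.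
  by move=> hN h0; rewrite -(rankN hN h0) subKn ?dimvS ?subvf.
rewrite !rad_dim // leqnn andbT.
pose W := ((form_rad f)^C)%VS; pose d := linfun (diagonal W).
have d_onto : (d @: N = fullv)%VS.
  apply/eqP; rewrite eqEdim subvf dim_rV /=.
  have := limg_ker_dim d N; rewrite diagonal_injective // dimv0 add0n dimN => ->.
  by rewrite dim_form_rad_compl.
apply/subvP => v vg; have: v \in (form_rad f + W)%VS.
  by rewrite addv_complf memvf.
case/memv_addP => x xf [w wW def_v]; rewrite def_v.
suff -> : w = 0 by rewrite addr0.
rewrite (coord_vbasis wW) big1 // => j _.
have /memv_imgP[h hN dh] : delta_mx 0 j \in (d @: N)%VS by rewrite d_onto memvf.
have hS := subvP NS _ hN.
have := constant_rank_isotropic gN g0 hN vg.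
rewrite def_v form_square_sum // (constant_rank_isotropic fN) // add0r.
rewrite (form_square_diagonal hS wW) (bigD1 j) //= big1 => [|i ij].
  move: dh; rewrite lfunE /= => <-; rewrite mxE !eqxx mulr1 addr0 => /eqP.
  by rewrite expf_eq0 /= => /eqP->; rewrite scale0r.
by move: dh; rewrite lfunE /= => <-; rewrite mxE (negPf ij) andbF mulr0.
Qed.

End OddConstantRank.
End Characteristic2.

(** * Sums of two forms with complementary radicals *)

(** On rad f the form f + g is g, and a vector of rad f that is g-orthogonal to
    rad f is also g-orthogonal to rad g, so it lies in both radicals. *)
Lemma nondegenerate_on_form_rad f g : f \in Symm V -> g \in Symm V ->
    (form_rad f :&: form_rad g = 0)%VS -> (form_rad f + form_rad g = fullv)%VS ->
  nondegenerate_on (f + g) (form_rad f).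
Proof.
move=> fS gS fg0 fgV x xf hx; apply/eqP; rewrite -memv0 -fg0 memv_cap xf /=.
apply/form_radP => v; have: v \in (form_rad f + form_rad g)%VS.
  by rewrite fgV memvf.
case/memv_addP => y yf [z /form_radP zg ->].
rewrite formDr [X in _ + X](form_sym _ _ gS) zg addr0.
have := hx y yf; rewrite !add_lfunE.
by move/form_radP: xf => ->; rewrite add0r.
Qed.

(** The two radicals are orthogonal under f + g, which is non-degenerate on
    each of them. *)
Lemma nondegenerate_sum f g : f \in Symm V -> g \in Symm V ->
    (form_rad f :&: form_rad g = 0)%VS -> (form_rad f + form_rad g = fullv)%VS ->
  nondegenerate_on (f + g) fullv.
Proof.
move=> fS gS fg0 fgV x _ hx; have: x \in (form_rad f + form_rad g)%VS.
  by rewrite fgV memvf.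
have cross p q : p \in form_rad f -> q \in form_rad g -> (f + g) p q = 0.
  move=> /form_radP pf /form_radP qg.
  by rewrite !add_lfunE pf (form_sym _ _ gS) qg addr0.
have hS : f + g \in Symm V by rewrite memvD.
case/memv_addP => p pf [q qg def_x].
have p0 : p = 0.
  apply: (nondegenerate_on_form_rad fS gS) => // y yf.
  have := hx y (memvf y).
  by rewrite def_x formDl [X in _ + X](form_sym _ _ hS) (cross y q) // addr0.
have q0 : q = 0.
  apply: (nondegenerate_on_form_rad gS fS) => // [||y yg]; rewrite 1?capvC 1?addvC //.
  have := hx y (memvf y).
  by rewrite def_x formDl cross // add0r addrC.
by rewrite def_x p0 q0 addr0.
Qed.

End BilinearForms.

(** * Symmetric forms of rank r or 2r *)

Section TwoRanks.

Context {K : fieldType} {V : vectType K}.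
Variables (r n : nat) (M : {vspace bilform K V}).
Hypotheses (r_odd : odd r) (n2r : n = (2 * r)%N).
Hypothesis charK : 2%N \in [pchar K].
Hypothesis cardK : exists g : 'I_r.+1 -> K, injective g.
Hypotheses (dimV : \dim {:V} = n) (M_symm : (M <= Symm V)%VS).
Hypothesis dimM : \dim M = (3 * r)%N.
Hypothesis rankM : forall f : bilform K V, f \in M -> f != 0 ->
  form_rank f = r \/ form_rank f = n.

Implicit Types (f g : bilform K V) (N : {vspace bilform K V}) (u : V).

Local Lemma r_gt0 : (0 < r)%N. Proof. by case: r r_odd. Qed.

Local Lemma r_neq_n : r <> n.
Proof. by move=> rn; move: r_odd; rewrite rn n2r oddM. Qed.

Lemma form_rank_killed f u : f \in M -> f != 0 -> u \in form_rad f -> u != 0 ->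
  form_rank f = r.
Proof.
move=> fM f0 uf u0; case: (rankM fM f0) => // rf.
by move: uf; rewrite form_rad_eq0 ?rf ?dimV // memv0 (negPf u0).
Qed.

Lemma dim_form_rad f : form_rank f = r -> \dim (form_rad f) = r.
Proof.
move=> rf; rewrite -(subKn (dimvS (subvf (form_rad f)))) -/(form_rank f).
by rewrite rf dimV n2r mul2n -addnn addnK.
Qed.

(** Evaluation at u maps M to the dual of V, so its kernel has dimension at least
    3r - 2r; the reverse bound is the one for odd constant rank. *)
Lemma forms_killing_rank u : u != 0 -> dim_constant_rank r M (forms_killing M u).
Proof.
move=> u0; have sM : (forms_killing M u <= M)%VS by apply: capvSl.
have cr : constant_rank r (forms_killing M u).
  move=> f /forms_killingP[fM fu] f0.
  by apply: (form_rank_killed fM f0 _ u0); apply/form_radP.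
split=> //; apply/eqP; rewrite eqn_leq.
rewrite (odd_constant_rank_dim charK r_odd cardK (subv_trans sM M_symm) cr) /=.
have := dim_cap_lker_ge (linfun (form_at u)) M.
by rewrite dim_dual dimV n2r dimM mulSn leq_add2r.
Qed.

Lemma common_form_rad N f g : dim_constant_rank r M N ->
  f \in N -> f != 0 -> g \in N -> g != 0 -> form_rad f = form_rad g.
Proof.
move=> [NM dimN rankN].
exact: (odd_constant_rank_common_radical charK r_odd cardK (subv_trans NM _)).
Qed.

Lemma constant_rank_nonzero N : dim_constant_rank r M N -> vpick N != 0.
Proof.
by move=> [_ dimN _]; rewrite vpick0 -dimv_eq0 dimN -lt0n r_gt0.
Qed.

(** The common radical of N contains u, so N lies in the space of the elements
    killing u, which has the same dimension. *)
Lemma constant_rank_forms_killing N f u : dim_constant_rank r M N ->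
  f \in N -> f != 0 -> u \in form_rad f -> u != 0 -> N = forms_killing M u.
Proof.
move=> rN fN f0 uf u0; have [NM dimN _] := rN.
have [_ dimK _] := forms_killing_rank u0.
apply/eqP; rewrite eqEdim dimN dimK leqnn andbT; apply/subvP => g gN.
apply/forms_killingP; split; first exact: subvP NM _ gN.
have [->|g0] := eqVneq g 0; first by move=> v; rewrite !lfunE.
by apply/form_radP; rewrite -(common_form_rad rN fN f0 gN g0).
Qed.

Lemma rank_r_nonzero_rad f : form_rank f = r -> vpick (form_rad f) != 0.
Proof.
by move=> rf; rewrite vpick0 -dimv_eq0 dim_form_rad // -lt0n r_gt0.
Qed.

Lemma common_radical_exists N : dim_constant_rank r M N ->
  common_radical N (form_rad (vpick N)).
Proof.
move=> rN f fN f0.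
exact: (common_form_rad rN fN f0 (memv_pick N) (constant_rank_nonzero rN)).
Qed.

Lemma constant_rank_is_killing N : dim_constant_rank r M N ->
  exists2 u : V, u != 0 & N = forms_killing M u.
Proof.
move=> rN; have f0 := constant_rank_nonzero rN; have fN := memv_pick N.
have [_ _ /(_ _ fN f0) rf] := rN; exists (vpick (form_rad (vpick N))).
  exact: rank_r_nonzero_rad.
exact: constant_rank_forms_killing (memv_pick _) (rank_r_nonzero_rad rf).
Qed.

(** Both spaces are the space of elements of M killing x. *)
Lemma form_rad_meet N N1 f g x : dim_constant_rank r M N ->
    dim_constant_rank r M N1 -> f \in N -> f != 0 -> g \in N1 -> g != 0 ->
  x \in form_rad f -> x \in form_rad g -> x != 0 -> N = N1.
Proof.
move=> rN rN1 fN f0 gN1 g0 xf xg x0.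
by rewrite (constant_rank_forms_killing rN fN f0 xf x0)
           (constant_rank_forms_killing rN1 gN1 g0 xg x0).
Qed.

Lemma constant_rank_disjoint N N1 : dim_constant_rank r M N ->
  dim_constant_rank r M N1 -> N <> N1 -> (N :&: N1 = 0)%VS.
Proof.
move=> rN rN1 neqN; apply/eqP; rewrite -subv0; apply/subvP => f.
move=> /memv_capP[fN fN1]; rewrite memv0; apply/negPn/negP => f0; apply: neqN.
have [_ _ /(_ _ fN f0) rf] := rN.
exact: form_rad_meet (memv_pick (form_rad f)) (memv_pick _) (rank_r_nonzero_rad rf).
Qed.

(** A non-zero v lies in the radical attached to the elements of M killing v; the
    zero vector lies in any member, and there is one because V is not zero. *)
Lemma radical_spread : spread r (fun R : {vspace V} =>
  exists2 N : {vspace bilform K V},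
    dim_constant_rank r M N & common_radical N R).
Proof.
have radE N R : dim_constant_rank r M N -> common_radical N R ->
    R = form_rad (vpick N).
  by move=> rN NR; rewrite (NR _ (memv_pick N)) // constant_rank_nonzero.
split=> [R [N rN NR]|R R1 [N rN NR] [N1 rN1 NR1] neqR|v].
- rewrite (radE _ _ rN NR); apply: dim_form_rad; have [_ _] := rN.
  by apply; rewrite ?memv_pick ?constant_rank_nonzero.
- apply/eqP; rewrite -subv0; apply/subvP => x /memv_capP[xR xR1].
  rewrite memv0; apply/negPn/negP => x0; apply: neqR.
  rewrite (radE _ _ rN NR) in xR *; rewrite (radE _ _ rN1 NR1) in xR1 *.
  have -> // : N = N1.
  by apply: form_rad_meet xR xR1 x0; rewrite ?memv_pick ?constant_rank_nonzero.
have [u u0 vu] : exists2 u : V, u != 0 & v = u \/ v = 0.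
  have [->|v0] := eqVneq v 0; last by exists v; [|left].
  exists (vpick {:V}); last by right.
  by rewrite vpick0 -dimv_eq0 dimV n2r muln_eq0 /= -lt0n r_gt0.
have rN := forms_killing_rank u0.
exists (form_rad (vpick (forms_killing M u))).
  by exists (forms_killing M u); last exact: common_radical_exists.
case: vu => ->; last exact: mem0v.
have /forms_killingP[_ ku] := memv_pick (forms_killing M u).
exact/form_radP.
Qed.

Lemma alternating_full_rank f : f \in M -> f \in Alt V -> f != 0 -> form_rank f = n.
Proof.
move=> fM fA f0; case: (rankM fM f0) => // rf.
by have := alternating_even_rank (subvP M_symm _ fM) fA; rewrite rf r_odd.
Qed.

Section TwoSubspaces.

Variables (N N1 : {vspace bilform K V}).
Hypotheses (rN : dim_constant_rank r M N) (rN1 : dim_constant_rank r M N1).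
Hypothesis neqN : N <> N1.

(** The radicals of f and g have dimension r = n / 2 and meet trivially, as
    otherwise N = N1. *)
Lemma sum_nondegenerate f g : f \in N -> f != 0 -> g \in N1 -> g != 0 ->
  nondegenerate_on (f + g) (form_rad f) /\ nondegenerate_on (f + g) fullv.
Proof.
move=> fN f0 gN1 g0; have [NM dimN rkN] := rN; have [NM1 dimN1 rkN1] := rN1.
have fS := subvP (subv_trans NM M_symm) _ fN.
have gS := subvP (subv_trans NM1 M_symm) _ gN1.
have fg0 : (form_rad f :&: form_rad g = 0)%VS.
  apply/eqP; rewrite -subv0; apply/subvP => x /memv_capP[xf xg].
  rewrite memv0; apply/negPn/negP => x0; apply: neqN.
  exact: (form_rad_meet rN rN1 fN f0 gN1 g0 xf xg x0).
have fgV : (form_rad f + form_rad g = fullv)%VS.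
  apply/eqP; rewrite eqEdim subvf dimv_disjoint_sum // !dim_form_rad ?(rkN f) ?(rkN1 g) //.
  by rewrite dimV n2r mul2n addnn leqnn.
by split; [apply: nondegenerate_on_form_rad | apply: nondegenerate_sum].
Qed.

Lemma dim_sum : \dim (N + N1) = n.
Proof.
have [_ dimN _] := rN; have [_ dimN1 _] := rN1.
by rewrite dimv_disjoint_sum ?constant_rank_disjoint // dimN dimN1 n2r mul2n addnn.
Qed.

(** If both components g and h of f are non-zero, then f is non-degenerate on
    rad g, whose dimension r is odd. *)
Lemma sum_alternating f : f \in (N + N1)%VS -> f \in Alt V -> f = 0.
Proof.
case/memv_addP => g gN [h hN1 ->] ghA.
have [NM dimN rkN] := rN; have [NM1 dimN1 rkN1] := rN1.
have alt0 (N' : {vspace bilform K V}) e : dim_constant_rank r M N' -> e \in N' ->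
    e \in Alt V -> e = 0.
  move=> [N'M _ rkN'] eN' eA; apply/eqP/negPn/negP => e0; apply: r_neq_n.
  by rewrite -(rkN' e eN' e0) (alternating_full_rank (subvP N'M _ eN') eA e0).
have [g0|g0] := eqVneq g 0.
  by move: ghA; rewrite g0 add0r; apply: alt0 hN1.
have [h0|h0] := eqVneq h 0.
  by move: ghA; rewrite h0 addr0; apply: alt0 gN.
have [nd _] := sum_nondegenerate gN g0 hN1 h0.
have := alternating_even_dim ghA nd.
by rewrite dim_form_rad ?rkN // r_odd.
Qed.

Lemma sum_rank_r f : f \in (N + N1)%VS -> form_rank f = r -> f \in N \/ f \in N1.
Proof.
case/memv_addP => g gN [h hN1 ->] rf.
have [g0|g0] := eqVneq g 0; first by right; rewrite g0 add0r.
have [h0|h0] := eqVneq h 0; first by left; rewrite h0 addr0.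
have [_ nd] := sum_nondegenerate gN g0 hN1 h0.
have := nondegenerate_on_rank nd; rewrite rf dimV n2r mul2n -addnn.
by rewrite -{3}[r]addn0 leq_add2l leqNgt r_gt0.
Qed.

Lemma sum_subset : (N + N1 <= M)%VS.
Proof. by have [NM _ _] := rN; have [NM1 _ _] := rN1; rewrite subv_add NM. Qed.

(** The common form of the decompositions of M by a third constant rank space
    and by the alternating forms. *)
Lemma sum_complement (P : {vspace bilform K V}) : (P <= M)%VS -> (r <= \dim P)%N ->
    ((N + N1) :&: P = 0)%VS ->
  [/\ (M = N + N1 + P)%VS, directv (N + N1 + P) & \dim P = r].
Proof.
move=> PM rP P0; have sM : (N + N1 + P <= M)%VS by rewrite subv_add sum_subset.
have dimS : \dim (N + N1 + P) = (n + \dim P)%N.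
  by rewrite dimv_disjoint_sum // dim_sum.
have dimP : \dim P = r.
  apply/eqP; rewrite eqn_leq rP andbT -(leq_add2l n) -dimS.
  by rewrite n2r -mulSnr -dimM dimvS.
split=> //.
  apply/esym/eqP; rewrite eqEdim sM dimS dimP dimM n2r.
  by rewrite -mulSnr leqnn.
have [_ dimN _] := rN; have [_ dimN1 _] := rN1.
by rewrite directvE /= dimS dimN dimN1 n2r mul2n addnn.
Qed.

Lemma sum_third N2 : dim_constant_rank r M N2 -> N2 <> N -> N2 <> N1 ->
  ((N + N1) :&: N2 = 0)%VS.
Proof.
move=> rN2 n20 n21; apply/eqP; rewrite -subv0; apply/subvP => f.
move=> /memv_capP[fS fN2]; rewrite memv0; apply/negPn/negP => f0.
have [_ _ /(_ _ fN2 f0) rf] := rN2.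
have disj N' : dim_constant_rank r M N' -> N2 <> N' -> f \notin N'.
  move=> rN' neq; apply: contraNN f0 => fN'.
  by rewrite -memv0 -(constant_rank_disjoint rN2 rN' neq) memv_cap fN2.
case: (sum_rank_r fS rf) => fN; first by case/negP: (disj N rN n20).
by case/negP: (disj N1 rN1 n21).
Qed.

Lemma sum_alternating_part :
  [/\ (M = N + N1 + (M :&: Alt V))%VS,
      directv (N + N1 + (M :&: Alt V)) & \dim (M :&: Alt V) = r].
Proof.
apply: sum_complement; first exact: capvSl.
  have := dim_alternating_ge charK M_symm.
  by rewrite dimV dimM n2r mulSn leq_add2r.
apply/eqP; rewrite -subv0; apply/subvP => f /memv_capP[fS /memv_capP[_ fA]].
by rewrite (sum_alternating fS fA) mem0v.
Qed.

End TwoSubspaces.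
End TwoRanks.

Theorem theorem6 (r n : nat) (r_odd : odd r) (n2r : n = (2 * r)%N)
    (K : fieldType) (charK : 2%N \in [pchar K])
    (cardK : exists g : 'I_r.+1 -> K, injective g)
    (V : vectType K) (dimV : \dim {:V} = n)
    (M : {vspace bilform K V}) (M_symm : (M <= Symm V)%VS)
    (dimM : \dim M = (3 * r)%N)
    (rankM : forall f : bilform K V, f \in M -> f != 0 ->
       form_rank f = r \/ form_rank f = n) :
  [/\ (* (1) *)
      forall N : {vspace bilform K V}, dim_constant_rank r M N ->
        exists2 u : V, u != 0 & N = forms_killing M u,
      (* (2) *)
      forall N N1 : {vspace bilform K V},
        dim_constant_rank r M N -> dim_constant_rank r M N1 -> N <> N1 ->
        (N :&: N1 = 0)%VS,
      (* (3) *)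
      (forall N : {vspace bilform K V}, dim_constant_rank r M N ->
         exists R : {vspace V}, common_radical N R)
      /\ spread r (fun R : {vspace V} =>
           exists2 N : {vspace bilform K V},
             dim_constant_rank r M N & common_radical N R),
      (* (4) *)
      forall N N1 : {vspace bilform K V},
        dim_constant_rank r M N -> dim_constant_rank r M N1 -> N <> N1 ->
        [/\ directv (N + N1),
            \dim (N + N1) = n,
            forall f : bilform K V,
              f \in (N + N1)%VS -> f \in Alt V -> f = 0,
            forall f : bilform K V,
              f \in (N + N1)%VS -> form_rank f = r -> f \in N \/ f \in N1
          & forall N2 : {vspace bilform K V},
              dim_constant_rank r M N2 -> N2 <> N -> N2 <> N1 ->
              [/\ ((N + N1) :&: N2 = 0)%VS,
                  (M = N + N1 + N2)%VS
                & directv (N + N1 + N2)]]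
    & (* (5) *)
      forall N N1 : {vspace bilform K V},
        dim_constant_rank r M N -> dim_constant_rank r M N1 -> N <> N1 ->
        [/\ (M = N + N1 + (M :&: Alt V))%VS,
            directv (N + N1 + (M :&: Alt V)),
            \dim (M :&: Alt V) = r
          & constant_rank n (M :&: Alt V)]].
Proof.
split.
- by move=> N; apply: constant_rank_is_killing rankM _.
- by move=> N N1; apply: constant_rank_disjoint rankM _ _.
- split; last exact: radical_spread rankM.
  move=> N rN; exists (form_rad (vpick N)).
  exact: (common_radical_exists r_odd charK cardK M_symm rN).
- move=> N N1 rN rN1 neqN; split.
  + apply/directv_addP.
    exact: constant_rank_disjoint rankM _ _ rN rN1 neqN.
  + exact: dim_sum rankM _ _ rN rN1 neqN.
  + exact: sum_alternating rankM _ _ rN rN1 neqN.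
  + exact: sum_rank_r rankM _ _ rN rN1 neqN.
  move=> N2 rN2 n20 n21; have [N2M dimN2 _] := rN2.
  have N20 : ((N + N1) :&: N2 = 0)%VS.
    exact: sum_third rankM _ _ rN rN1 neqN _ rN2 n20 n21.
  by have [] := sum_complement r_odd n2r charK cardK dimV M_symm dimM rankM
    rN rN1 neqN N2M (eq_leq (esym dimN2)) N20.
move=> N N1 rN rN1 neqN.
have [defM dirM dimA] := sum_alternating_part r_odd n2r charK cardK dimV M_symm
  dimM rankM rN rN1 neqN.
split=> // f /memv_capP[fM fA] f0.
exact: alternating_full_rank r_odd M_symm rankM _ fM fA f0.
Qed.
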